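(* We have $r_{sub}(\mathcal{Y})\le r_{max}(\mathcal{Y})$ for every $\mathcal{Y}\in\mathbf{T}$, and $r_{sub}(\mathcal{X})<r_{max}(\mathcal{X})$ for some $\mathcal{X}\in\mathbf{T}$. Thus $r_{max}\ne r_*$, where $r_*$ is the smallest tensor rank function. Furthermore, $r_*$ is strongly proper.
   Context: $\mathbf{Z}_+$ is the set of nonnegative integers and $\mathbf{N}$ the set of positive integers. For $m,n_1,\dots,n_m\in\mathbf{N}$, $\mathbf{T}(n_1,\dots,n_m)$ is the set of real $m$th order tensors $\mathcal{X}=(x_{i_1\cdots i_m})$ of dimension $n_1\times\cdots\times n_m$; $\mathbf{CT}(m,n)$ is the case $n_1=\cdots=n_m=n$; $\mathbf{T}$ is the set of all real tensors (all orders $m\ge1$, all dimensions). A tensor $\mathcal{X}\in\mathbf{T}(n_1,\dots,n_m)$ is rank-one if $\mathcal{X}=\mathbf{x}^{(1)}\circ\cdots\circ\mathbf{x}^{(m)}$ (outer product) with nonzero $\mathbf{x}^{(i)}\in\mathbb{R}^{n_i}$. The identity tensor $\mathcal{I}_{m,n}\in\mathbf{CT}(m,n)$ has entries $1$ when $i_1=\cdots=i_m$ and $0$ otherwise. A subtensor of $\mathcal{X}\in\mathbf{T}(n_1,\dots,n_m)$ is a tensor of the same order $m$ obtained by choosing nonempty index sets $T_l\subseteq\{1,\dots,n_l\}$, $l=1,\dots,m$, and restricting $\mathcal{X}$ to $T_1\times\cdots\times T_m$; it is an element of $\mathbf{T}(|T_1|,\dots,|T_m|)$. A function $r:\mathbf{T}\to\mathbf{Z}_+$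 is a tensor rank function if: (1) $r(\mathcal{X})=0$ iff $\mathcal{X}$ is a zero tensor, and $r(\mathcal{X})=1$ iff $\mathcal{X}$ is a rank-one tensor; (2) $r(\mathcal{I}_{m,n})=n$ for all $m,n\in\mathbf{N}$ with $m\ge2$; (3) for $\mathcal{X}\in\mathbf{T}(n_1,n_2,1,\dots,1)$ (order at least $2$), $r(\mathcal{X})$ equals the matrix rank of the $n_1\times n_2$ matrix corresponding to $\mathcal{X}$; (4) $r(\alpha\mathcal{X})=r(\mathcal{X})$ for every tensor $\mathcal{X}$ and real $\alpha\ne0$; (5) $r(\mathcal{Y})=r(\mathcal{X})$ whenever $\mathcal{Y}$ is obtained from $\mathcal{X}$ by permuting its modes, i.e. $\sigma$ is a permutation of the $m$ coordinates, $\mathcal{Y}$ has dimensions $\sigma(n_1,\dots,n_m)$, and the entry of $\mathcal{Y}$ at position $\sigma(i_1,\dots,i_m)$ is $x_{i_1\cdots i_m}$; (6) $r(\mathcal{Y})\le r(\mathcal{X})$ whenever $\mathcal{Y}$ is a subtensor of $\mathcal{X}$. The smallest tensor rank function $r_*$ is the unique tensor rank function with $r_*(\mathcal{X})\le r(\mathcal{X})$ for every tensor rank function $r$ and every $\mathcal{X}\in\mathbf{T}$; explicitly, $r_*(\mathcal{X})=\min\{r(\mathcal{X}): r\text{ is a tensor rank function}\}$. The number $\mathrm{submax}$ of a list of $m\ge2$ numbers is its second largest value counted with multiplicity. A tensor rank function $r$ is strongly proper if $r(\mathcal{X})\le\mathrm{submax}\{n_1,\dots,n_m\}$ for all $m,n_1,\dots,n_m\in\mathbf{N}$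 with $m\ge2$ and $\mathcal{X}\in\mathbf{T}(n_1,\dots,n_m)$. Mode-$j$ unfolding: $X_{(j)}\in\mathbb{R}^{n_j\times(n_1\cdots n_{j-1}n_{j+1}\cdots n_m)}$ is the matrix whose rows are indexed by $i_j$, whose columns are indexed by the remaining indices, and whose entries are $x_{i_1\cdots i_m}$ (an $n_1\times1$ matrix for $m=1$). Let $r_j$ be the matrix rank of $X_{(j)}$. The max-Tucker rank is $r_{max}(\mathcal{X})=\max\{r_1,\dots,r_m\}$. The submax-Tucker rank is $r_{sub}(\mathcal{X})=\mathrm{submax}\{r_1,\dots,r_m\}$ for $m\ge2$; for $m=1$ it is $0$ if $\mathcal{X}=0$ and $1$ otherwise. Both are tensor rank functions. *)

(* Defs.v *)
From HB Require Import structures.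
From mathcomp Require Import all_boot all_order all_fingroup all_algebra.
From mathcomp Require Import boolp classical_sets reals.

Set Implicit Arguments.
Unset Strict Implicit.
Unset Printing Implicit Defensive.
Import GRing.Theory.
Local Open Scope ring_scope.

Definition multi_index (m : nat) (n : 'I_m -> nat) : finType :=
  {dffun forall l : 'I_m, 'I_(n l)}.

(* [RealTensor X m_gt0 n_gt0] : the tensor X in T(n_1,...,n_m); the type
   [real_tensor R] is the set T of real tensors of all orders m >= 1 and of all
   dimensions n_l >= 1. Modes and indices are numbered from 0. *)
Record real_tensor (R : realType) := RealTensor {
  tensor_order : nat;
  dim : 'I_tensor_order -> nat;
  entries : {ffun multi_index dim -> R};
  tensor_order_gt0 : (0 < tensor_order)%N;
  dim_gt0 : forall l, (0 < dim l)%N }.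

Section RankFunctions.
Variable R : realType.
Local Notation T := (real_tensor R).

Definition scale_tensor (a : R) (X : T) : T :=
  RealTensor [ffun i => a * entries X i] (tensor_order_gt0 X) (@dim_gt0 R X).

Definition rank_one (X : T) : Prop :=
  exists2 x : forall l : 'I_(tensor_order X), 'rV[R]_(dim l),
    forall l, x l != 0 &
    forall i : multi_index (@dim R X), entries X i = \prod_l x l 0 (i l).

Definition identity_tensor (m n : nat) (m_gt1 : (1 < m)%N) (n_gt0 : (0 < n)%N)
    : T :=
  @RealTensor R m (fun=> n)
    [ffun i : multi_index (fun=> n) => ([forall k, forall l, i k == i l])%:R]
    (ltnW m_gt1) (fun=> n_gt0).

(* On a subset of 'I_n, [enum_val] is the increasing enumeration. *)
Definition subtensor (X : T)
    (S : forall l : 'I_(tensor_order X), {set 'I_(dim l)})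
    (S_gt0 : forall l, (0 < #|S l|)%N) : T :=
  @RealTensor R (tensor_order X) (fun l => #|S l|)
    [ffun j : multi_index (fun l => #|S l|) =>
       entries X [ffun l => enum_val (j l)]]
    (tensor_order_gt0 X) S_gt0.

Record tensor_rank_function (r : T -> nat) : Prop := TensorRankFunction {
  trf_zero : forall X, r X = 0%N <-> entries X = 0;
  trf_one : forall X, r X = 1%N <-> rank_one X;
  trf_identity : forall m n (m_gt1 : (1 < m)%N) (n_gt0 : (0 < n)%N),
    r (identity_tensor m_gt1 n_gt0) = n;
  (* M is the n_1 x n_2 matrix corresponding to X in T(n_1,n_2,1,...,1). *)
  trf_matrix : forall (X : T) (l1 l2 : 'I_(tensor_order X))
      (M : 'M[R]_(dim l1, dim l2)),
    l1 = 0%N :> nat -> l2 = 1%N :> nat ->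
    (forall l : 'I_(tensor_order X), (1 < l)%N -> dim l = 1%N) ->
    (forall i : multi_index (@dim R X), entries X i = M (i l1) (i l2)) ->
    r X = \rank M;
  trf_scale : forall (a : R) X, a != 0 -> r (scale_tensor a X) = r X;
  trf_perm : forall (X : T) (s : 'S_(tensor_order X))
      (Y : {ffun multi_index (fun l => dim (s l)) -> R}),
    (forall i : multi_index (@dim R X), Y [ffun l => i (s l)] = entries X i) ->
    r (RealTensor Y (tensor_order_gt0 X) (fun l => dim_gt0 (s l))) = r X;
  trf_subtensor : forall (X : T)
      (S : forall l : 'I_(tensor_order X), {set 'I_(dim l)})
      (S_gt0 : forall l, (0 < #|S l|)%N),
    (r (subtensor S_gt0) <= r X)%N }.

Local Open Scope classical_set_scope.

(* The minimum of the values r X over all tensor rank functions r. The default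
   value 0 of [xget] is irrelevant: see [smallest_rankP]. *)
Definition smallest_rank (X : T) : nat :=
  xget 0%N [set k | (exists2 r, tensor_rank_function r & r X = k) /\
                    (forall r, tensor_rank_function r -> (k <= r X)%N)].

Local Close Scope classical_set_scope.

Lemma smallest_rankP (r0 : T -> nat) (X : T) : tensor_rank_function r0 ->
  (exists2 r, tensor_rank_function r & r X = smallest_rank X) /\
  (forall r, tensor_rank_function r -> (smallest_rank X <= r X)%N).
Proof.
move=> r0P; rewrite /smallest_rank; case: xgetP => [k _ //|none].
have ex : exists k, `[< exists2 r, tensor_rank_function r & r X = k >].
  by exists (r0 X); apply/asboolP; exists r0.
case: (ex_minnP ex) => k /asboolP kP kmin; case: (none k); split=> // r rP.
by apply: kmin; apply/asboolP; exists r.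
Qed.

Definition submax (s : seq nat) : nat := nth 0%N (sort geq s) 1.

Definition strongly_proper (r : T -> nat) : Prop :=
  tensor_rank_function r /\
  forall X : T, (1 < tensor_order X)%N ->
    (r X <= submax [seq dim l | l : 'I_(tensor_order X)])%N.

Section Unfolding.
Variables (m : nat) (n : 'I_m -> nat) (j : 'I_m).

Definition other_index : finType :=
  {dffun forall l : {l : 'I_m | l != j}, 'I_(n (val l))}.

Definition insert_index (a : 'I_(n j)) (c : other_index) : multi_index n :=
  [ffun l => match l =P j with
             | ReflectT e => cast_ord (congr1 n (esym e)) a
             | ReflectF ne => c (exist _ l (introN eqP ne))
             end].

Definition unfolding (X : {ffun multi_index n -> R}) :
    'M[R]_(n j, #|other_index|) :=
  \matrix_(a, c) X (insert_index a (enum_val c)).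

End Unfolding.

Definition mode_rank (X : T) (j : 'I_(tensor_order X)) : nat :=
  \rank (unfolding j (entries X)).

Definition max_tucker_rank (X : T) : nat :=
  \max_(j < tensor_order X) mode_rank j.

Definition submax_tucker_rank (X : T) : nat :=
  if tensor_order X == 1%N then (if entries X == 0 then 0%N else 1%N)
  else submax [seq mode_rank j | j : 'I_(tensor_order X)].

End RankFunctions.

(* Main.v *)
Require Import Defs.
From mathcomp Require Import all_boot all_order all_fingroup all_algebra.
From mathcomp Require Import reals.

(** The mode-[j] rank of a tensor X is at most k iff X can be written
    [X i = \sum_(t < k) u (i j) t * v t i] with [v t i] independent of the
    [j]-th coordinate of [i]. This turns every axiom of a tensor rank function,
    for the submax-Tucker rank, into an elementary manipulation of such
    factorizations: in particular, if all modes but one have rank at most one,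
    then one factor can be split off for each of these modes, and the tensor is
    rank-one. Hence r_* is bounded by r_sub, which is itself bounded by the
    submax of the dimensions, and which differs from r_max as soon as a single
    mode rank exceeds all the others. *)

Set Implicit Arguments.
Unset Strict Implicit.
Unset Printing Implicit Defensive.

Import GRing.Theory.

(** * The second largest value of a list *)

(** Sorting preserves counts, and in a nonincreasing list the entries above [k] form a prefix. Lists
    with fewer than two entries fit as well, the default second entry being 0. *)
Lemma submax_leE (s : seq nat) k : (submax s <= k) = (count (ltn k) s <= 1).
Proof.
have /seq.permP <- : perm_eq (sort geq s) s by rewrite perm_sort.
have: sorted geq (sort geq s) by apply: sort_sorted => x y; exact: leq_total.
have geq_trans : transitive geq by move=> y x z yx zy; exact: leq_trans zy yx.
rewrite /submax; case: (sort geq s) => [|x [|y t]] //=; first by case: (k < x).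
rewrite (path_sortedE geq_trans) => /and3P[yx /allP ty _].
have [yk|ky] := leqP y k; last by rewrite (leq_trans ky yx).
rewrite add0n (_ : count _ t = 0) ?addn0 ?leq_b1//.
apply/eqP; rewrite -leqn0 leqNgt -has_count -all_predC.
by apply/allP => z /ty zy /=; rewrite -leqNgt (leq_trans zy yk).
Qed.

Section SubmaxImage.
Variable m : nat.
Implicit Types f g : 'I_m -> nat.

(** Trades sorting for a condition on pairs of distinct indices, from which the later bounds on
    [submax] are derived. *)
Lemma submax_imageP f k :
  reflect (forall i j, i != j -> minn (f i) (f j) <= k)
          (submax [seq f i | i : 'I_m] <= k).
Proof.
rewrite submax_leE count_map -size_filter.
have -> : size [seq i <- enum 'I_m | preim f (ltn k) i] = #|[pred i | k < f i]|.
  by rewrite cardE enumT /enum_mem; congr size; apply: eq_filter.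
apply: (iffP card_le1_eqP) => [le1 i j|le1 i j].
  by rewrite geq_min; apply: contraNT; rewrite negb_or -!ltnNge => /andP[? ?];
     apply/eqP/le1.
rewrite !inE => ki kj; apply/eqP; apply: contraTT ki => ji.
by have := le1 _ _ ji; rewrite geq_min leqNgt kj/= leqNgt.
Qed.

Lemma minn_le_submax f i j :
  i != j -> minn (f i) (f j) <= submax [seq f i | i : 'I_m].
Proof. by move: i j; apply/submax_imageP. Qed.

Lemma leq_submax_image f g :
  (forall i, f i <= g i) ->
  submax [seq f i | i : 'I_m] <= submax [seq g i | i : 'I_m].
Proof.
move=> fg; apply/submax_imageP => i j /(minn_le_submax g); apply: leq_trans.
by rewrite leq_min !geq_min !fg orbT.
Qed.

Lemma submax_image_const f k : 1 < m -> (forall i, f i = k) ->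
  submax [seq f i | i : 'I_m] = k.
Proof.
move=> m_gt1 fk; apply/eqP; rewrite eqn_leq; apply/andP; split.
  by apply/submax_imageP => i j _; rewrite !fk minnn.
have ne : Ordinal (ltnW m_gt1) != Ordinal m_gt1 by [].
by have := minn_le_submax f ne; rewrite !fk minnn.
Qed.

Lemma submax_image_perm f (s : {perm 'I_m}) :
  submax [seq f (s i) | i : 'I_m] = submax [seq f i | i : 'I_m].
Proof.
apply/eqP; rewrite eqn_leq; apply/andP; split; apply/submax_imageP => i j ij.
  by apply: minn_le_submax; rewrite (inj_eq perm_inj).
rewrite -(permKV s i) -(permKV s j); apply: (minn_le_submax (f \o s)).
by rewrite (inj_eq perm_inj).
Qed.

End SubmaxImage.


(* [case] on the boolean reflection in [insert_index] is ill typed, because the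
   branches mention the reflected boolean. *)
Lemma match_reflect (P : Prop) b (r : reflect P b) A (f : P -> A)
    (g : ~ P -> A) (x : A) :
  (forall p, f p = x) -> (forall np, g np = x) ->
  match r with ReflectT p => f p | ReflectF np => g np end = x.
Proof. by case: r. Qed.

(** * Ranks of unfoldings and factorizations *)

Section ModeRank.
Local Open Scope ring_scope.
Variables (R : realType) (m : nat) (n : 'I_m -> nat).
Implicit Types (X : {ffun multi_index n -> R}) (i : multi_index n).

(** Invariance under [upd] in mode [j] expresses independence of the [j]-th coordinate. *)
Definition upd i j (a : 'I_(n j)) : multi_index n := [ffun l => dfwith i a l].

Lemma updE i j a : @upd i j a j = a.
Proof. by rewrite ffunE dfwith_in. Qed.

Lemma updNE i j a l : l != j -> @upd i j a l = i l.
Proof. by move=> lj; rewrite ffunE dfwith_out// eq_sym. Qed.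

Lemma upd_id i j : upd i (i j) = i.
Proof.
by apply/ffunP => l; have [->|/updNE//] := eqVneq l j; rewrite updE.
Qed.

Lemma insert_indexE j (a : 'I_(n j)) c : insert_index a c j = a.
Proof.
by rewrite ffunE; apply: match_reflect => // e; rewrite cast_ord_id.
Qed.

Lemma insert_indexNE j (a : 'I_(n j)) c l (lj : l != j) :
  insert_index a c l = c (exist _ l lj).
Proof.
rewrite ffunE; apply: match_reflect => [e|ne]; first by case/eqP: (lj).
by congr (c (exist _ l _)); apply: bool_irrelevance.
Qed.

(** Locates the column of the mode-[j] unfolding that contains the entry at [i]. *)
Definition off_mode j i : other_index n j := [ffun l => i (val l)].

Lemma insert_off_mode j i : insert_index (i j) (off_mode j i) = i.
Proof.
apply/ffunP => l; have [->|lj] := eqVneq l j; first by rewrite insert_indexE.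
by rewrite insert_indexNE ffunE.
Qed.

(** This is the rank factorization of the unfolding into column and row bases, read entry by
    entry. *)
Lemma mode_factor X j : exists u v,
  [/\ forall t i (a : 'I_(n j)), v t (upd i a) = v t i &
      forall i, X i = \sum_(t < \rank (unfolding j X)) u (i j) t * v t i].
Proof.
exists (fun a t => col_base (unfolding j X) a t).
exists (fun t i => row_base (unfolding j X) t (enum_rank (off_mode j i))).
split=> [t i a|i].
  congr (row_base _ _ (enum_rank _)); apply/ffunP => l.
  by rewrite !ffunE dfwith_out// eq_sym (valP l).
have := congr1 (fun M : 'M_(_, _) => M (i j) (enum_rank (off_mode j i)))
  (mulmx_base (unfolding j X)).
by rewrite !mxE enum_rankK insert_off_mode.
Qed.

(** Such a factorization writes the unfolding as a matrix product of inner dimension [k]. *)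
Lemma rank_unfolding_le X j k (u : 'I_(n j) -> 'I_k -> R)
    (v : 'I_k -> multi_index n -> R) :
  (forall t i (a : 'I_(n j)), v t (upd i a) = v t i) ->
  (forall i, X i = \sum_t u (i j) t * v t i) ->
  (\rank (unfolding j X) <= k)%N.
Proof.
move=> v_upd Xuv; have [n0|] := posnP (n j).
  by rewrite (leq_trans (rank_leq_row _))// n0.
(* Any [j]-th coordinate will do, since [v] ignores it; one exists once [n j] is positive. *)
move=> n_gt0; pose a0 := Ordinal n_gt0.
suff -> : unfolding j X = \matrix_(a, t) u a t *m
    \matrix_(t, c) v t (insert_index a0 (enum_val c)).
  exact: mulmx_max_rank.
apply/matrixP => a c; rewrite !mxE Xuv; apply: eq_bigr => t _.
rewrite !mxE insert_indexE; congr (_ * _).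
rewrite -(v_upd t (insert_index a0 _) a); congr (v t _); apply/ffunP => l.
have [->|lj] := eqVneq l j; first by rewrite updE insert_indexE.
by rewrite updNE// !insert_indexNE.
Qed.

(** The matrix consists of columns of the unfolding, possibly repeated. Lower bounds on mode ranks
    come from a suitable choice of these columns. *)
Lemma rank_slice_le X j q (c : 'I_q -> multi_index n) :
  (\rank (\matrix_(a < n j, b < q) X (upd (c b) a)) <= \rank (unfolding j X))%N.
Proof.
have [u [v [v_upd Xuv]]] := mode_factor X j.
suff -> : \matrix_(a < n j, b < q) X (upd (c b) a) =
    \matrix_(a, t) u a t *m \matrix_(t, b) v t (c b).
  exact: mulmx_max_rank.
apply/matrixP => a b; rewrite !mxE Xuv; apply: eq_bigr => t _.
by rewrite !mxE updE v_upd.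
Qed.

Lemma rank_unfolding_eq0 X j : (\rank (unfolding j X) == 0)%N = (X == 0).
Proof.
apply/eqP/eqP => [rX0|->]; last first.
  suff -> : @unfolding R m n j 0 = 0 by rewrite mxrank0.
  by apply/matrixP => a c; rewrite !mxE ffunE.
have [u [v [_ Xuv]]] := mode_factor X j.
apply/ffunP => i; rewrite Xuv ffunE big1// => t _.
by have := ltn_ord t; rewrite {2}rX0.
Qed.

Lemma rank_unfoldingZ X j (a : R) : a != 0 ->
  \rank (unfolding j [ffun i => a * X i]) = \rank (unfolding j X).
Proof.
move=> a0; suff -> : unfolding j [ffun i => a * X i] = a *: unfolding j X.
  exact: mxrank_scale_nz.
by apply/matrixP => b c; rewrite !mxE ffunE.
Qed.

(** The four entries form a 2 x 2 minor of the unfolding, in the rows [i j], [i' j] and the columns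
    of [i], [i']. *)
Lemma rank_unfolding_le1 X j i i' : (\rank (unfolding j X) <= 1)%N ->
  X i * X i' = X (upd i (i' j)) * X (upd i' (i j)).
Proof.
have [u [v [v_upd Xuv]]] := mode_factor X j => r1.
have {}r1 : forall t t' : 'I_(\rank (unfolding j X)), t = t'.
  move=> t t'; apply: ord_inj; have := leq_trans (ltn_ord t) r1.
  by have := leq_trans (ltn_ord t') r1; rewrite !ltnS !leqn0 => /eqP-> /eqP->.
rewrite !Xuv !big_distrlr; apply: eq_bigr => t _; apply: eq_bigr => t' _ /=.
by rewrite (r1 t' t) !updE !v_upd mulrACA (mulrC (u _ _)) mulrACA.
Qed.

(** By induction on [s]: exchanging the [j]-th coordinates of [i] and [i0] resets that of [i] to
    [i0 j] at the cost of one factor depending on [i j] alone. *)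
Lemma rank_unfolding_le1_prod X (i0 : multi_index n) (s : seq 'I_m) :
  X i0 != 0 -> uniq s ->
  (forall j, j \in s -> (\rank (unfolding j X) <= 1)%N) ->
  forall i, X i = X [ffun l => if l \in s then i0 l else i l] *
                  \prod_(j <- s) (X (upd i0 (i j)) / X i0).
Proof.
move=> X0; elim: s => [_ _ i|j s IHs /= /andP[js us] rs i].
  by rewrite big_nil mulr1; congr (X _); apply/ffunP => l; rewrite ffunE.
have /(@rank_unfolding_le1 _ _ i i0) Xi : (\rank (unfolding j X) <= 1)%N.
  by apply: rs; rewrite mem_head.
have /IHs IH : forall j', j' \in s -> (\rank (unfolding j' X) <= 1)%N.
  by move=> l ls; apply: rs; rewrite inE ls orbT.
have -> : X i = X (upd i (i0 j)) * (X (upd i0 (i j)) / X i0).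
  by rewrite mulrA -Xi mulfK.
rewrite big_cons (IH us) -mulrA [X in _ * X]mulrC.
congr (X _ * (_ * _)); last first.
  (* As [j] is not in [s], resetting it leaves the remaining factors unchanged. *)
  apply: eq_big_seq => l ls; rewrite updNE//.
  by apply: contraNneq js => <-.
apply/ffunP => l; rewrite !ffunE inE.
have [->|lj] := eqVneq l j; first by rewrite (negPf js) dfwith_in.
by rewrite dfwith_out// eq_sym.
Qed.

(** Around a nonzero entry [X i0], splitting off all modes other than [j0] leaves a function of the
    coordinate [j0] alone, which is the last vector. *)
Lemma rank_one_of_rank_unfolding X j0 : X != 0 ->
  (forall j, j != j0 -> (\rank (unfolding j X) <= 1)%N) ->
  exists2 x : forall l, 'rV[R]_(n l), forall l, x l != 0 &
    forall i, X i = \prod_l x l 0 (i l).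
Proof.
move=> X_neq0 r1.
have [i0 X0] : exists i0, X i0 != 0.
  apply/existsP; apply: contraNT X_neq0 => /existsPn X0.
  by apply/eqP/ffunP => i; rewrite ffunE; apply/eqP; rewrite -[_ == _]negbK.
(* These are the fibres of [X] through [i0], normalized to 1 at [i0] except in mode [j0], which
   carries the scale. *)
pose x l : 'rV_(n l) :=
  \row_a (X (upd i0 a) / (if l == j0 then 1 else X i0)).
exists x => [l|i].
  apply/eqP => /matrixP/(_ 0 (i0 l)) /eqP.
  rewrite !mxE upd_id mulf_eq0 (negPf X0).
  by case: ifP => _; rewrite invr_eq0 ?oner_eq0 ?(negPf X0).
have us : uniq [seq l <- index_enum 'I_m | l != j0].
  by rewrite filter_uniq// index_enum_uniq.
have rs j : j \in [seq l <- index_enum 'I_m | l != j0] ->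
    (\rank (unfolding j X) <= 1)%N.
  by rewrite mem_filter => /andP[/r1].
rewrite (rank_unfolding_le1_prod X0 us rs) (bigD1 j0)//= mxE eqxx divr1.
congr (X _ * _).
  apply/ffunP => l; rewrite ffunE mem_filter mem_index_enum andbT.
  by have [->|lj] /= := eqVneq l j0; rewrite ?updE// updNE.
rewrite big_filter; apply: eq_bigr => l lj.
by rewrite mxE (negPf lj).
Qed.

Lemma rank_unfolding_prod X (x : forall l, 'rV[R]_(n l)) j :
  (forall i, X i = \prod_l x l 0 (i l)) -> (\rank (unfolding j X) <= 1)%N.
Proof.
move=> Xx; apply: (@rank_unfolding_le X j 1 (fun a _ => x j 0 a)
  (fun _ i => \prod_(l | l != j) x l 0 (i l))) => [_ i a|i].
  by apply: eq_bigr => l lj; rewrite updNE.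
by rewrite big_ord1 Xx (bigD1 j).
Qed.


End ModeRank.

(** * The submax-Tucker rank is a tensor rank function *)

Section TuckerRank.
Local Open Scope ring_scope.

(** Reindexing by [s] is a bijection matching coordinate [j] with coordinate [s j], so
    factorizations transport in both directions. *)
Lemma rank_unfolding_perm (R : realType) m (n : 'I_m -> nat) (s : {perm 'I_m})
    (X : {ffun multi_index n -> R})
    (Y : {ffun multi_index (fun l => n (s l)) -> R}) j :
  (forall i : multi_index n, Y [ffun l => i (s l)] = X i) ->
  \rank (unfolding j Y) = \rank (unfolding (s j) X).
Proof.
move=> YX.
pose ns l := n (s l).
pose f (i : multi_index n) : multi_index ns := [ffun l => i (s l)].
(* The inverse reindexing requires a cast; it is specified only at [s l], where the cast
   disappears. *)
have [g gE] : exists g : multi_index ns -> multi_index n,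
    forall (i : multi_index ns) l, g i (s l) = i l.
  exists (fun i : multi_index ns =>
    [ffun l => cast_ord (congr1 n (permKV s l)) (i ((s^-1)%g l))]).
  move=> i l; rewrite ffunE; move: (congr1 _ _); rewrite permK => e.
  by rewrite cast_ord_id.
have fK (i : multi_index n) : g (f i) = i.
  by apply/ffunP => l; rewrite -(permKV s l) gE ffunE.
have gK (i : multi_index ns) : f (g i) = i.
  by apply/ffunP => l; rewrite ffunE gE.
have g_upd (i : multi_index ns) (a : 'I_(ns j)) :
    g (upd i a) = upd (g i) (a : 'I_(n (s j))).
  apply/ffunP => l; rewrite -(permKV s l) gE.
  have [->|lj] := eqVneq ((s^-1)%g l) j; first by rewrite !updE.
  by rewrite !updNE ?gE// (inj_eq perm_inj).
apply/eqP; rewrite eqn_leq; apply/andP; split.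
  have [u [v [v_upd Xuv]]] := mode_factor X (s j).
  apply: (rank_unfolding_le (u := u) 
    (v := fun t (i : multi_index ns) => v t (g i))) => [t i a|i].
    by rewrite g_upd v_upd.
  by rewrite -{1}(gK i) YX Xuv gE.
have [u [v [v_upd Yuv]]] := mode_factor Y j.
apply: (rank_unfolding_le (u := u) (v := fun t i => v t (f i))) => [t i a|i].
  by rewrite -{1}(fK i) -g_upd gK v_upd.
by rewrite -YX Yuv ffunE.
Qed.

Variable R : realType.
Implicit Types X : real_tensor R.

Lemma mode_rank_eq0 X (j : 'I_(tensor_order X)) :
  (mode_rank j == 0)%N = (entries X == 0).
Proof. exact: rank_unfolding_eq0. Qed.

Lemma mode_rank_le_dim X (j : 'I_(tensor_order X)) :
  (mode_rank j <= Defs.dim j)%N.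
Proof. exact: rank_leq_row. Qed.

Lemma submax_tucker_le_max X : (submax_tucker_rank X <= max_tucker_rank X)%N.
Proof.
rewrite /submax_tucker_rank; case: ifP => _.
  (* In order one a nonzero tensor has value 1 by convention, and its mode rank is positive. *)
  case: eqVneq => // X0; rewrite /max_tucker_rank.
  apply: (leq_trans _ (leq_bigmax (Ordinal (tensor_order_gt0 X)))).
  by rewrite lt0n mode_rank_eq0.
apply/submax_imageP => i j _; rewrite (leq_trans (geq_minl _ _))//.
exact: (leq_bigmax i).
Qed.

Lemma submax_tuckerE X : (1 < tensor_order X)%N ->
  submax_tucker_rank X = submax [seq mode_rank j | j : 'I_(tensor_order X)].
Proof. by move=> o2; rewrite /submax_tucker_rank gtn_eqF. Qed.

Lemma submax_tucker_order1 X : tensor_order X = 1%N ->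
  submax_tucker_rank X = (entries X != 0).
Proof. by move=> /eqP o1; rewrite /submax_tucker_rank o1; case: eqP. Qed.

Lemma tensor_order_eq1_or_gt1 X :
  tensor_order X = 1%N \/ (1 < tensor_order X)%N.
Proof.
by case: (tensor_order X) (tensor_order_gt0 X) => [|[|]]//; [left|right].
Qed.

(** One vanishing mode rank already forces the tensor, hence all mode ranks, to vanish. *)
Lemma submax_tucker_eq0 X : submax_tucker_rank X = 0%N <-> entries X = 0.
Proof.
case: (tensor_order_eq1_or_gt1 X) => [X1|X2].
  by rewrite submax_tucker_order1//; case: (eqVneq (entries X)) => // /eqP.
rewrite submax_tuckerE//; split=> [r0|X0]; last first.
  by apply: submax_image_const => // j; apply/eqP; rewrite mode_rank_eq0 X0.
have ne : Ordinal (ltnW X2) != Ordinal X2 by [].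
have := minn_le_submax (@mode_rank R X) ne; rewrite r0 geq_min !leqn0.
by rewrite !mode_rank_eq0 orbb => /eqP.
Qed.

Lemma rank_one_neq0 X : rank_one X -> entries X != 0.
Proof.
move=> [x x0 Xx].
have {}x0 l : exists a, x l 0 a != 0.
  apply/existsP; apply: contraNT (x0 l) => /existsPn xl.
  by apply/eqP/rowP => a; rewrite mxE; apply/eqP; rewrite -[_ == _]negbK.
apply/eqP => /ffunP/(_ [ffun l => xchoose (x0 l)])/eqP; apply/negP.
rewrite Xx ffunE; apply/prodf_neq0 => l _; rewrite ffunE.
exact: (xchooseP (x0 l)).
Qed.

(** A second largest mode rank of at most 1 leaves at most one mode [j0] of larger rank, and the
    other modes split off. *)
Lemma submax_tucker_eq1 X : submax_tucker_rank X = 1%N <-> rank_one X.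
Proof.
split=> [r1|X1]; last first.
  have r_neq0 : (submax_tucker_rank X != 0)%N.
    by apply/eqP => /submax_tucker_eq0/eqP; apply/negP/rank_one_neq0.
  apply/eqP; rewrite eqn_leq lt0n r_neq0 andbT {r_neq0}.
  case: (tensor_order_eq1_or_gt1 X) => [o1|o2].
    by rewrite submax_tucker_order1// leq_b1.
  rewrite submax_tuckerE//; apply/submax_imageP => i j _.
  have [x _ Xx] := X1.
  by rewrite (leq_trans (geq_minl _ _))//; apply: rank_unfolding_prod Xx.
have X0 : entries X != 0 by apply/eqP => /submax_tucker_eq0; rewrite r1.
suff [j0 j0P] : exists j0, forall j : 'I_(tensor_order X),
    j != j0 -> (mode_rank j <= 1)%N.
  exact: rank_one_of_rank_unfolding X0 j0P.
case: (tensor_order_eq1_or_gt1 X) => [o1|o2].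
  (* In order one no mode differs from [j0]. *)
  exists (Ordinal (tensor_order_gt0 X)) => j /eqP[]; apply: ord_inj => /=.
  by have := ltn_ord j; rewrite {2}o1 ltnS leqn0 => /eqP.
have /submax_imageP le1 :
    (submax [seq mode_rank j | j : 'I_(tensor_order X)] <= 1)%N.
  by rewrite -submax_tuckerE// r1.
have [/= j0 j0P|all_le1] :=
  pickP [pred j : 'I_(tensor_order X) | (1 < mode_rank j)%N].
  exists j0 => j /le1; rewrite geq_min => /orP[//|].
  by rewrite leqNgt j0P.
exists (Ordinal (tensor_order_gt0 X)) => j _.
by rewrite leqNgt; apply/negbT/all_le1.
Qed.

Lemma submax_tucker_identity m n (m_gt1 : (1 < m)%N) (n_gt0 : (0 < n)%N) :
  submax_tucker_rank (identity_tensor R m_gt1 n_gt0) = n.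
Proof.
rewrite submax_tuckerE//; apply: submax_image_const => // j.
apply/eqP; rewrite eqn_leq mode_rank_le_dim/=.
(* The columns through the diagonal positions form the identity matrix. *)
pose c (b : 'I_n) : multi_index (fun _ : 'I_m => n) := [ffun=> b].
pose X := entries (identity_tensor R m_gt1 n_gt0).
apply: leq_trans (@rank_slice_le _ _ _ X j _ c).
rewrite -{1}(mxrank1 R n); apply/eq_leq; congr (\rank _).
(* A second mode keeps the value [b] while mode [j] takes the value [a], so the entry is 1 only for
   [a = b]. *)
have [l lj] : exists l : 'I_m, l != j.
  have [->|j0] := eqVneq j (Ordinal m_gt1).
    by exists (Ordinal (ltnW m_gt1)).
  by exists (Ordinal m_gt1); rewrite eq_sym.
apply/matrixP => a b; rewrite !mxE ffunE; congr (_%:R : R).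
have [->|ab] := eqVneq a b.
  apply/esym/eqP; rewrite eqb1; apply/forallP => k; apply/forallP => k'.
  have -> : @upd _ _ (c b) j b = c b by rewrite -[RHS](upd_id _ j) ffunE.
  by rewrite !ffunE.
apply/esym/eqP; rewrite eqb0; apply: contra ab => /forallP/(_ j)/forallP/(_ l).
by rewrite updE updNE// ffunE.
Qed.

(** The first two modes have the ranks of [M] and its transpose, and every other mode has dimension
    1. *)
Lemma submax_tucker_matrix X (l1 l2 : 'I_(tensor_order X))
    (M : 'M[R]_(Defs.dim l1, Defs.dim l2)) :
  l1 = 0%N :> nat -> l2 = 1%N :> nat ->
  (forall l : 'I_(tensor_order X), (1 < l)%N -> Defs.dim l = 1%N) ->
  (forall i : multi_index (@Defs.dim R X), entries X i = M (i l1) (i l2)) ->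
  submax_tucker_rank X = \rank M.
Proof.
move=> l10 l21 dim1 XM.
have o2 : (1 < tensor_order X)%N by rewrite -l21.
have l12 : l1 != l2 by rewrite -val_eqE/= l10 l21.
pose i0 : multi_index (@Defs.dim R X) := [ffun l => Ordinal (dim_gt0 l)].
have r1 : mode_rank l1 = \rank M.
  apply/eqP; rewrite eqn_leq; apply/andP; split.
    apply: (@rank_unfolding_le _ _ _ _ l1 _ (fun a t => col_base M a t)
      (fun t i => row_base M t (i l2))) => [t i a|i].
      by rewrite updNE// eq_sym.
    by rewrite XM -{1}(mulmx_base M) !mxE.
  (* The columns obtained by varying coordinate [l2] of [i0] reproduce [M]. *)
  apply: leq_trans (@rank_slice_le _ _ _ (entries X) l1 _ (@upd _ _ i0 l2)).
  apply/eq_leq; congr (\rank _); apply/matrixP => a b.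
  by rewrite !mxE XM updE updNE 1?eq_sym// updE.
have r2 : mode_rank l2 = \rank M.
  rewrite -(mxrank_tr M); apply/eqP; rewrite eqn_leq; apply/andP; split.
    apply: (@rank_unfolding_le _ _ _ _ l2 _ (fun a t => col_base M^T a t)
      (fun t i => row_base M^T t (i l1))) => [t i a|i].
      by rewrite updNE.
    by have := congr1 (fun N : 'M_(_, _) => N (i l2) (i l1)) (mulmx_base M^T);
      rewrite !mxE -XM.
  apply: leq_trans (@rank_slice_le _ _ _ (entries X) l2 _ (@upd _ _ i0 l1)).
  apply/eq_leq; congr (\rank _); apply/matrixP => a b.
  by rewrite !mxE XM updE updNE// updE.
(* For nonzero [X] the rank of [M] is at least 1, which bounds the modes of dimension 1. *)
have [X0|X0] := eqVneq (entries X) 0.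
  rewrite (submax_tucker_eq0 X).2// -r1.
  by apply/esym/eqP; rewrite mode_rank_eq0 X0.
rewrite submax_tuckerE//; apply/eqP; rewrite eqn_leq; apply/andP; split.
  have le_M (l : 'I_(tensor_order X)) : (mode_rank l <= \rank M)%N.
    have [->|ll1] := eqVneq l l1; first by rewrite r1.
    have [->|ll2] := eqVneq l l2; first by rewrite r2.
    apply: (leq_trans (mode_rank_le_dim l)).
    rewrite dim1 -?r1 ?lt0n ?mode_rank_eq0//.
    by move: ll1 ll2; rewrite -!val_eqE/= l10 l21; case: (val l) => [|[|]].
  by apply/submax_imageP => i j _; rewrite (leq_trans (geq_minl _ _)).
by have := minn_le_submax (@mode_rank R X) l12; rewrite r1 r2 minnn.
Qed.

Lemma submax_tucker_scale (a : R) X : a != 0 ->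
  submax_tucker_rank (scale_tensor a X) = submax_tucker_rank X.
Proof.
move=> a0; have rZ (j : 'I_(tensor_order X)) :
  @mode_rank R (scale_tensor a X) j = mode_rank j by exact: rank_unfoldingZ.
have Z0 : (entries (scale_tensor a X) == 0) = (entries X == 0).
  pose j := Ordinal (tensor_order_gt0 X).
  by rewrite -(mode_rank_eq0 j) -(@mode_rank_eq0 (scale_tensor a X) j) rZ.
rewrite /submax_tucker_rank Z0 /=.
by congr (if _ then _ else submax _); apply: eq_map.
Qed.

Lemma submax_tucker_perm X (s : 'S_(tensor_order X))
    (Y : {ffun multi_index (fun l => Defs.dim (s l)) -> R}) :
  (forall i : multi_index (@Defs.dim R X),
     Y [ffun l => i (s l)] = entries X i) ->
  submax_tucker_rank
    (RealTensor Y (tensor_order_gt0 X) (fun l => dim_gt0 (s l))) =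
  submax_tucker_rank X.
Proof.
set TY := RealTensor _ _ _ => YX.
have rY (j : 'I_(tensor_order X)) : @mode_rank R TY j = mode_rank (s j).
  exact: rank_unfolding_perm.
have Y0 : (Y == 0) = (entries X == 0).
  pose j := Ordinal (tensor_order_gt0 X).
  by rewrite -(mode_rank_eq0 (s j)) -rY (@mode_rank_eq0 TY).
rewrite /submax_tucker_rank/= Y0; case: ifP => // _.
by rewrite -[RHS](submax_image_perm _ s); congr submax; apply: eq_map.
Qed.

(** A factorization of [X] restricts to the selected indices, so no mode rank increases. *)
Lemma submax_tucker_subtensor X
    (S : forall l : 'I_(tensor_order X), {set 'I_(Defs.dim l)})
    (S_gt0 : forall l, (0 < #|S l|)%N) :
  (submax_tucker_rank (subtensor S_gt0) <= submax_tucker_rank X)%N.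
Proof.
pose f (i : multi_index (fun l => #|S l|)) : multi_index (@Defs.dim R X) :=
  [ffun l => enum_val (i l)].
have rS (j : 'I_(tensor_order X)) :
    (@mode_rank R (subtensor S_gt0) j <= mode_rank j)%N.
  have [u [v [v_upd Xuv]]] := mode_factor (entries X) j.
  apply: (@rank_unfolding_le _ _ _ _ j _ (fun a => u (enum_val a))
      (fun t i => v t (f i))) => [t i a|i].
    rewrite -(v_upd t (f i) (enum_val a)); congr (v t _); apply/ffunP => l.
    rewrite ffunE; have [->|lj] := eqVneq l j; first by rewrite !updE.
    by rewrite !updNE// ffunE.
  by rewrite ffunE Xuv ffunE.
case: (tensor_order_eq1_or_gt1 X) => [o1|o2].
  rewrite !submax_tucker_order1//; have := rS (Ordinal (tensor_order_gt0 X)).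
  rewrite -(@mode_rank_eq0 (subtensor S_gt0) (Ordinal (tensor_order_gt0 X))).
  rewrite -(mode_rank_eq0 (Ordinal (tensor_order_gt0 X))).
  by case: (mode_rank _) => // ?; case: (mode_rank _).
by rewrite !submax_tuckerE//; apply: leq_submax_image.
Qed.

Lemma submax_tucker_rank_function :
  tensor_rank_function (@submax_tucker_rank R).
Proof.
split.
- exact: submax_tucker_eq0.
- exact: submax_tucker_eq1.
- exact: submax_tucker_identity.
- exact: submax_tucker_matrix.
- exact: submax_tucker_scale.
- exact: submax_tucker_perm.
- exact: submax_tucker_subtensor.
Qed.

(** * The smallest tensor rank function *)

Lemma smallest_rank_le r X :
  tensor_rank_function r -> (smallest_rank X <= r X)%N.
Proof. by move=> rP; have [_] := smallest_rankP X rP; apply. Qed.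

Lemma smallest_rank_attained X :
  exists2 r, tensor_rank_function r & r X = smallest_rank X.
Proof. by have [] := smallest_rankP X submax_tucker_rank_function. Qed.

Lemma eq_smallest_rank X Y :
  (forall r, @tensor_rank_function R r -> r X = r Y) ->
  smallest_rank X = smallest_rank Y.
Proof.
move=> XY; apply/eqP; rewrite eqn_leq; apply/andP; split.
  have [r rP <-] := smallest_rank_attained Y.
  by rewrite -XY//; apply: smallest_rank_le.
have [r rP <-] := smallest_rank_attained X.
by rewrite XY//; apply: smallest_rank_le.
Qed.

(** Axioms prescribing a value pass from a function attaining the minimum at that tensor;
    invariances hold because the minima range over equal values. For subtensors, a function
    attaining the minimum at [X] bounds the minimum at the subtensor. *)
Lemma smallest_rank_function : tensor_rank_function (@smallest_rank R).
Proof.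
split.
- by move=> X; have [r rP <-] := smallest_rank_attained X; apply: trf_zero.
- by move=> X; have [r rP <-] := smallest_rank_attained X; apply: trf_one.
- move=> m n m_gt1 n_gt0.
  by have [r rP <-] := smallest_rank_attained (identity_tensor R m_gt1 n_gt0);
     apply: trf_identity.
- move=> X l1 l2 M l10 l21 dim1 XM.
  by have [r rP <-] := smallest_rank_attained X; apply: (trf_matrix rP).
- by move=> a X a0; apply: eq_smallest_rank => r rP; apply: trf_scale.
- by move=> X s Y YX; apply: eq_smallest_rank => r rP; apply: trf_perm.
- move=> X S S_gt0; have [r rP <-] := smallest_rank_attained X.
  by apply: leq_trans (trf_subtensor rP S_gt0); apply: smallest_rank_le.
Qed.

(** Passes through the submax-Tucker rank, whose mode ranks are bounded by the dimensions. *)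
Lemma smallest_rank_strongly_proper : strongly_proper (@smallest_rank R).
Proof.
split=> [|X o2]; first exact: smallest_rank_function.
apply: leq_trans (smallest_rank_le X submax_tucker_rank_function) _.
by rewrite submax_tuckerE//; apply/leq_submax_image/mode_rank_le_dim.
Qed.

(** * A tensor separating the two Tucker ranks *)

(* A 4 x 2 x 2 tensor whose mode-1 unfolding is the identity matrix of order 4,
   the pairs of the last two indices being numbered in binary. *)
Definition binary_dim (l : 'I_3) : nat := (if l == ord0 then 3 else 1).+1.

Definition binary_tensor : real_tensor R :=
  @RealTensor R 3 binary_dim
    [ffun i : multi_index binary_dim =>
      ((i ord0 : nat) == (i 1%R).*2 + i ord_max)%N%:R]
    isT (fun=> isT).

(** Of two distinct modes, at least one has dimension 2. *)
Lemma submax_tucker_binary : (submax_tucker_rank binary_tensor <= 2)%N.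
Proof.
rewrite submax_tuckerE//; apply/submax_imageP => i j ij.
have le2 (l : 'I_3) : l != ord0 -> (@mode_rank R binary_tensor l <= 2)%N.
  move=> l0; apply: leq_trans (mode_rank_le_dim _) _.
  by rewrite /= /binary_dim (negPf l0).
rewrite geq_min; have [i0|/le2->//] := eqVneq i ord0.
by rewrite (le2 j) ?orbT// -i0 eq_sym.
Qed.

Lemma max_tucker_binary : (4 <= max_tucker_rank binary_tensor)%N.
Proof.
apply: leq_trans (leq_bigmax (ord0 : 'I_3)).
(* The last two coordinates are the binary digits of [b]; the first one is overwritten by [upd]. *)
pose c (b : 'I_4) : multi_index binary_dim :=
  [ffun l => inord (if l == 1 then b./2 else odd b)].
apply: leq_trans (@rank_slice_le _ _ _ (entries binary_tensor) ord0 _ c).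
rewrite -{1}(mxrank1 R 4); apply/eq_leq; congr (\rank _).
apply/matrixP => a b.
rewrite !mxE !ffunE dfwith_in !dfwith_out// !ffunE /= !inordK //=.
- by rewrite addnC odd_double_half val_eqE.
- by case: (odd b).
- rewrite -ltn_double (leq_ltn_trans _ (ltn_ord b))//.
  by rewrite -{2}(odd_double_half b) leq_addl.
Qed.

End TuckerRank.

Theorem proposition3p5 (R : realType) :
  (forall Y : real_tensor R, submax_tucker_rank Y <= max_tucker_rank Y) /\
  (exists X : real_tensor R, submax_tucker_rank X < max_tucker_rank X) /\
  @max_tucker_rank R <> @smallest_rank R /\
  strongly_proper (@smallest_rank R).
Proof.
have lt_binary :
    submax_tucker_rank (binary_tensor R) < max_tucker_rank (binary_tensor R).
  apply: leq_trans (max_tucker_binary R).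
  exact: leq_ltn_trans (submax_tucker_binary R) _.
split; first exact: submax_tucker_le_max.
split; first by exists (binary_tensor R).
split; last exact: smallest_rank_strongly_proper.
(* Equality would make the max-Tucker rank minimal, hence at most the submax-Tucker rank at
   [binary_tensor]. *)
move=> max_smallest; move: lt_binary; rewrite max_smallest ltnNge.
by rewrite (smallest_rank_le _ (submax_tucker_rank_function R)).
Qed.
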